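(* Let $\mathcal S$ be a complete trajectory set which has no arbitrage nodes of type II. Then $\mathcal S$ has a martingale measure with finite support at finite maturities (i.e. $\mathcal M_0\neq\emptyset$), and $\mathcal S$ satisfies (nL) and (nK).
   Context: A trajectory set is any set $\mathcal T$ of real sequences $S=(S_j)_{j\in\mathbb N_0}$ with a common initial value $S_0$. $\mathcal S$ is complete if for every sequence $(S^n)_{n\ge0}$ in $\mathcal S$ with $S^n_i=S^{n+1}_i$ for $0\le i\le n$, $n\in\mathbb N_0$, the sequence $(S^i_i)_{i\in\mathbb N_0}$ belongs to $\mathcal S$. For a trajectory set $\mathcal T$: nodes are $\mathcal T_{(S,j)}=\{\tilde S\in\mathcal T:(\tilde S_0,\dots,\tilde S_j)=(S_0,\dots,S_j)\}$; $\mathcal T_{(S,j)}$ is an arbitrage node if for some $\varepsilon\in\{-1,1\}$, $\varepsilon(\tilde S_{j+1}-S_j)\ge0$ for all $\tilde S\in\mathcal T_{(S,j)}$ with strict inequality for at least one; of type I if some $S'\in\mathcal T_{(S,j)}$ has $S'_{j+1}=S_j$, of type II otherwise. Shifted conditional spaces: $\mathcal T^{(S,j)}=\{(\tilde S_{j+i})_{i\in\mathbb N_0}:\tilde S\in\mathcal T_{(S,j)}\}$. A simple portfolio $(V,n,H)$ consists of $V\in\mathbb R$, $n\in\mathbb N$ and nonanticipating $H_i:\mathcal T\to\mathbb R$ ($H_i(S)=h_i(S_0,\dots,S_i)$ for arbitrary $h_i$), $0\le i\le n-1$, with wealth $\Pi^{V,n,H}_j(S)=V+\sum_{i=0}^{\min\{j,n\}-1}H_i(S)(S_{i+1}-S_i)$,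 $\Pi^{V,n,H}_\infty:=\Pi^{V,n,H}_n$; positive if $V\ge0$ and $\Pi^{V,n,H}_\infty\ge0$ on $\mathcal T$. A generalized portfolio is a sequence $(V_m,n_m,H_m)_{m\in\mathbb N_0}$ of simple portfolios, positive for $m\ge1$; positive generalized if moreover $\Pi^{V_0,n_0,H_0}_j\equiv0$ for all $j$; it superhedges $f$ with initial endowment $\sum_{m=0}^\infty V_m$ if $f\le\sum_{m=0}^\infty\Pi^{V_m,n_m,H_m}_\infty$ on $\mathcal T$. $\bar I(f)$ ($f\ge0$) and $\bar\sigma(f)$ are the infima of initial endowments of positive generalized, resp. generalized, portfolios superhedging $f$. (L): $\bar\sigma(0)\ge0$. $\mathcal E=\{\Pi^{V,n,H}_\infty\}$; (LOP): simple portfolios with equal terminal wealth on $\mathcal T$ have equal initial endowments, and then $I(\Pi^{V,n,H}_\infty):=V$; (K): $I(f)+\bar I(f^-)\le\bar I(f^+)$ for all $f\in\mathcal E$. (nL) (resp. (nK)) for $\mathcal S$: every $\mathcal S^{(S,j)}$, $S\in\mathcal S$, $j\in\mathbb N_0$, satisfies (L) (resp. (LOP) and (K)). A martingale measure for $\mathcal S$ is a probability $Q$ on $(\mathcal S,\mathfrak A)$, $\mathfrak A$ the trace on $\mathcal S$ of the product Borel $\sigma$-field of $\mathbb R^{\mathbb N_0}$, under which the coordinate process $T_i(S)=S_i$ is a martingale w.r.t. its natural filtration; it has finite support at finite maturities if there is $\mathcal S'\in\mathfrak A$ with $Q(\mathcal S')=1$ such that $\{\mathcal S_{(S,j)}:S\in\mathcal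 S'\}$ is finite for every $j\in\mathbb N_0$; $\mathcal M_0$ is the set of these. *)

(* Defs.v *)
From HB Require Import structures.
From mathcomp Require Import all_boot all_order all_algebra.
From mathcomp Require Import all_classical all_reals all_analysis.
Unset Strict Implicit. Unset Printing Implicit Defensive.
Import Order.TTheory GRing.Theory Num.Theory.
Local Open Scope classical_set_scope.
Local Open Scope ring_scope.

Section TrajDefs.
Variable R : realType.
Notation seqR := (nat -> R).

Definition traj_set (T : set seqR) : Prop :=
  (exists S, T S) /\ exists x0 : R, forall S, T S -> S 0%N = x0.

Definition complete (T : set seqR) : Prop :=
  forall Sn : nat -> seqR, (forall n, T (Sn n)) ->
    (forall n i, (i <= n)%N -> Sn n i = Sn n.+1 i) ->
    T (fun i => Sn i i).

Definition node (T : set seqR) (S : seqR) (j : nat) : set seqR :=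
  [set St | T St /\ forall i, (i <= j)%N -> St i = S i].

Definition arbitrage_node (T : set seqR) (S : seqR) (j : nat) : Prop :=
  exists eps : R, (eps = 1 \/ eps = -1) /\
    (forall St, node T S j St -> 0 <= eps * (St j.+1 - S j)) /\
    (exists St, node T S j St /\ 0 < eps * (St j.+1 - S j)).

Definition arbitrage_node_typeI (T : set seqR) (S : seqR) (j : nat) : Prop :=
  arbitrage_node T S j /\ exists S', node T S j S' /\ S' j.+1 = S j.

Definition arbitrage_node_typeII (T : set seqR) (S : seqR) (j : nat) : Prop :=
  arbitrage_node T S j /\ ~ (exists S', node T S j S' /\ S' j.+1 = S j).

Definition no_typeII_arbitrage (T : set seqR) : Prop :=
  forall S j, T S -> ~ arbitrage_node_typeII T S j.

Definition shifted (T : set seqR) (S : seqR) (j : nat) : set seqR :=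
  [set (fun i => St (j + i)%N) | St in node T S j].

Record sportfolio := SPortfolio {
  pV : R;
  pn : nat;
  pn_gt0 : (0 < pn)%N;
  ph : forall i : nat, ('I_i.+1 -> R) -> R }.

Definition pH (p : sportfolio) (i : nat) (S : seqR) : R :=
  ph p i (fun k : 'I_i.+1 => S (nat_of_ord k)).

Definition wealth (p : sportfolio) (j : nat) (S : seqR) : R :=
  pV p + \sum_(0 <= i < minn j (pn p)) pH p i S * (S i.+1 - S i).

Definition twealth (p : sportfolio) (S : seqR) : R := wealth p (pn p) S.

Definition positive_sp (T : set seqR) (p : sportfolio) : Prop :=
  0 <= pV p /\ forall S, T S -> 0 <= twealth p S.

Definition gen_portfolio (T : set seqR) (P : nat -> sportfolio) : Prop :=
  forall m, (1 <= m)%N -> positive_sp T (P m).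

Definition pos_gen_portfolio (T : set seqR) (P : nat -> sportfolio) : Prop :=
  gen_portfolio T P /\ forall j S, T S -> wealth (P 0%N) j S = 0.

Definition endowment (P : nat -> sportfolio) : \bar R :=
  ((pV (P 0%N))%:E + \sum_(1 <= m <oo) (pV (P m))%:E)%E.

Definition superhedges (T : set seqR) (P : nat -> sportfolio) (f : seqR -> R) : Prop :=
  forall S, T S ->
    ((f S)%:E <= (twealth (P 0%N) S)%:E + \sum_(1 <= m <oo) (twealth (P m) S)%:E)%E.

Definition Ibar (T : set seqR) (f : seqR -> R) : \bar R :=
  ereal_inf [set endowment P | P in [set P | pos_gen_portfolio T P /\ superhedges T P f]].

Definition sigmabar (T : set seqR) (f : seqR -> R) : \bar R :=
  ereal_inf [set endowment P | P in [set P | gen_portfolio T P /\ superhedges T P f]].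

Definition condL (T : set seqR) : Prop := (0 <= sigmabar T (fun _ => 0%R))%E.

Definition condLOP (T : set seqR) : Prop :=
  forall p q : sportfolio, (forall S, T S -> twealth p S = twealth q S) -> pV p = pV q.

(* (K): I(f) + Ibar(f^-) <= Ibar(f^+) for f = Pi_infty^{V,n,H} in E, with I(f) = V *)
Definition condK (T : set seqR) : Prop :=
  forall p : sportfolio,
    ((pV p)%:E + Ibar T (fun S => Num.max (- twealth p S)%R 0%R)
      <= Ibar T (fun S => Num.max (twealth p S) 0%R))%E.

Definition condnL (T : set seqR) : Prop :=
  forall S j, T S -> condL (shifted T S j).

Definition condnK (T : set seqR) : Prop :=
  forall S j, T S -> condLOP (shifted T S j) /\ condK (shifted T S j).

(* The trajectory set as a (pointed) type; the base point is irrelevant. *)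
Definition trajT (T : set seqR) (s0 : seqR) (hs0 : T s0) : Type := {s : seqR | T s}.

Section Inst.
Variables (T : set seqR) (s0 : seqR) (hs0 : T s0).
HB.instance Definition _ := gen_eqMixin (trajT T s0 hs0).
HB.instance Definition _ := gen_choiceMixin (trajT T s0 hs0).
HB.instance Definition _ := isPointed.Build (trajT T s0 hs0) (exist _ s0 hs0).
End Inst.

Definition prod_borel : set (set seqR) :=
  <<s [set (fun s : seqR => s i) @^-1` B | i in [set: nat] & B in [set B : set R | measurable B]] >>.

Definition trace_gen (T : set seqR) (s0 : seqR) (hs0 : T s0) : set (set (trajT T s0 hs0)) :=
  [set (@proj1_sig _ _) @^-1` A | A in prod_borel].

Definition trajMeas (T : set seqR) (s0 : seqR) (hs0 : T s0) :=
  g_sigma_algebraType (trace_gen T s0 hs0).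

Definition nat_filtration (T : set seqR) (s0 : seqR) (hs0 : T s0) (i : nat)
  : set (set (trajMeas T s0 hs0)) :=
  <<s [set (fun s : trajMeas T s0 hs0 => proj1_sig s j) @^-1` B
        | j in [set j | (j <= i)%N] & B in [set B : set R | measurable B]] >>.

Definition martingale_measure (T : set seqR) (s0 : seqR) (hs0 : T s0)
  (Q : probability (trajMeas T s0 hs0) R) : Prop :=
  forall i : nat,
    Q.-integrable [set: trajMeas T s0 hs0] (fun s => (proj1_sig s i)%:E) /\
    forall A, nat_filtration T s0 hs0 i A ->
      (\int[Q]_(s in A) (proj1_sig s i.+1)%:E = \int[Q]_(s in A) (proj1_sig s i)%:E)%E.

Definition finite_support_finite_maturities (T : set seqR) (s0 : seqR) (hs0 : T s0)
  (Q : probability (trajMeas T s0 hs0) R) : Prop :=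
  exists S' : set (trajMeas T s0 hs0), measurable S' /\ Q S' = 1%E /\
    forall j : nat, finite_set [set node T (proj1_sig s) j | s in S'].

Definition M0_nonempty (T : set seqR) : Prop :=
  exists (s0 : seqR) (hs0 : T s0) (Q : probability (trajMeas T s0 hs0) R),
    martingale_measure T s0 hs0 Q /\ finite_support_finite_maturities T s0 hs0 Q.

End TrajDefs.

(* Main.v *)
(* Without arbitrage nodes of type II, every node has a successor at which the
   price does not move, or two successors, one up and one down; in both cases
   the current price is a mean, with positive weights, of at most two
   successor prices.

   Splitting [0, 1) repeatedly in proportion to these weights sends every
   point of [0, 1) to a sequence of nodes, hence by completeness to a
   trajectory; the image of Lebesgue measure is a martingale measure with
   finitely many nodes at each date.

   The total wealth of a generalized portfolio at a node is likewise the mean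
   of its values at these successors, so one can always move to a successor
   without increasing it. By completeness this yields a trajectory whose total
   terminal wealth is at most the endowment, which gives (L) and (LOP), and
   also shows that superhedging at infinity of a payoff of maturity n implies
   superhedging at every date from n on.

   For (K), let p be a simple portfolio with terminal wealth f. Replacing the
   zero part of a positive generalized superhedge of f^+ by -p gives a
   generalized superhedge of f^-, and it is enough to make it positive without
   raising its cost. At a node that is not an arbitrage node and where the
   total wealth is finite, its increments are proportional to the price
   increments, hence it is replicated by one simple portfolio up to the
   first nonzero move out of an arbitrage node. After such a move, costless
   portfolios betting on arbitrage nodes, taken infinitely often, superhedge
   everything. *)
Require Import Defs.
From mathcomp Require Import all_boot all_order all_algebra.
From mathcomp Require Import all_classical all_reals all_analysis.
From mathcomp Require Import measurable_realfun lra ring.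
Import Order.TTheory GRing.Theory Num.Theory.
Local Open Scope classical_set_scope.
Local Open Scope ring_scope.

#[local] Arguments node {R}.
#[local] Arguments arbitrage_node {R}.
#[local] Arguments shifted {R}.
#[local] Arguments pV {R}.
#[local] Arguments pn {R}.
#[local] Arguments pn_gt0 {R}.
#[local] Arguments ph {R}.
#[local] Arguments pH {R}.
#[local] Arguments wealth {R}.
#[local] Arguments twealth {R}.
#[local] Arguments positive_sp {R}.
#[local] Arguments gen_portfolio {R}.
#[local] Arguments endowment {R}.
#[local] Arguments superhedges {R}.

(** * Nodes and completeness *)

Definition agree {R : realType} (j : nat) (x y : nat -> R) :=
  forall i, (i <= j)%N -> x i = y i.

Definition adapted {R : realType} {U : Type} (phi : nat -> (nat -> R) -> U) :=
  forall j x y, agree j x y -> phi j x = phi j y.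

Section Nodes.
Context {R : realType}.
Implicit Types (T : set (nat -> R)) (S c d : nat -> R) (j : nat).

Lemma agree_sym j (x y : nat -> R) : agree j x y -> agree j y x.
Proof. by move=> h i ij; rewrite h. Qed.

Lemma agreeW j k (x y : nat -> R) : (j <= k)%N -> agree k x y -> agree j x y.
Proof. by move=> jk h i ij; rewrite h// (leq_trans ij). Qed.

Lemma agree_trans j (x y z : nat -> R) : agree j x y -> agree j y z -> agree j x z.
Proof. by move=> h k i ij; rewrite h// k. Qed.

Lemma node_agree T j (x y : nat -> R) : agree j x y -> node T x j = node T y j.
Proof.
move=> xy; apply/seteqP; split => z [Tz zx]; split => // i ij.
- by rewrite zx// xy.
- by rewrite zx// xy.
Qed.

Lemma arbitrage_node_adapted T : adapted (fun j S => arbitrage_node T S j).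
Proof.
by move=> j x y xy; rewrite /arbitrage_node (node_agree T _ _ _ xy) (xy j).
Qed.

(** If no successor moved against [c], all moves would weakly share the sign of the nonzero move of
    [c], and the node would be an arbitrage node. *)
Lemma opposite_move T S j c : ~ arbitrage_node T S j -> node T S j c ->
  c j.+1 != S j -> exists2 d, node T S j d & (c j.+1 - S j) * (d j.+1 - S j) < 0.
Proof.
move=> narb nc cS; apply: contrapT => nd; apply: narb.
have ge0 d : node T S j d -> 0 <= (c j.+1 - S j) * (d j.+1 - S j).
  by move=> nS; rewrite leNgt; apply/negP => h; apply: nd; exists d.
have [lt|ge] := ltP 0 (c j.+1 - S j).
- exists 1; split; [by left|split]; last by exists c; rewrite mul1r.
  by move=> d /ge0; rewrite mul1r pmulr_rge0.
- have lt : c j.+1 - S j < 0 by rewrite lt_neqAle ge subr_eq0 cS.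
  exists (-1); split; [by right|split]; last by exists c; rewrite mulN1r oppr_gt0.
  by move=> d /ge0; rewrite mulN1r oppr_ge0 nmulr_rge0.
Qed.

(** An arbitrage node without flat successor is of type II. So if no successor is flat, the node is
    not an arbitrage node, and [S], which moves, has an opposite move. *)
Lemma flat_or_opposite T S j : no_typeII_arbitrage R T -> T S ->
  (exists2 c, node T S j c & c j.+1 = S j) \/
  (exists c d, [/\ node T S j c, node T S j d, S j < c j.+1 & d j.+1 < S j]).
Proof.
move=> ntII TS; have [fl|nfl] := pselect (exists S', node T S j S' /\ S' j.+1 = S j).
  by left; case: fl => c []; exists c.
right; have narb : ~ arbitrage_node T S j by move=> ?; exact: (ntII S j).
have nS : node T S j S by [].
have SS : S j.+1 != S j by apply/eqP => e; apply: nfl; exists S.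
have [d nd lt0] := opposite_move _ _ _ _ narb nS SS.
have [lt|ge] := ltP 0 (S j.+1 - S j).
- exists S, d; split => //; first by rewrite -subr_gt0.
  by rewrite -subr_lt0 -(pmulr_rlt0 _ lt).
- have lt : S j.+1 - S j < 0 by rewrite lt_neqAle ge subr_eq0 SS.
  exists d, S; split => //; last by rewrite -subr_lt0.
  by rewrite -subr_gt0 -(nmulr_rlt0 _ lt).
Qed.

(** Dependent choice: [X k] and [X k.+1] agree up to date [j + k], so initial segments stabilize and
    completeness supplies the limit. [Q] is what is asked of each single step. *)
Lemma limit_path T (Q : nat -> (nat -> R) -> (nat -> R) -> Prop) :
  complete R T ->
  (forall S j, T S -> exists2 c, node T S j c & Q j S c) ->
  forall S j, T S -> exists X : nat -> nat -> R,
    [/\ X 0%N = S, forall k, T (X k), forall k, Q (j + k)%N (X k) (X k.+1) &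
      exists2 L, T L & forall k, agree (j + k) L (X k)].
Proof.
move=> cT step S j TS.
have /choice[f fP] : forall p : nat * {S | T S}, exists c : {S | T S},
    agree (j + p.1) (proj1_sig c) (proj1_sig p.2) /\ Q (j + p.1)%N (proj1_sig p.2) (proj1_sig c).
  move=> [k [x Tx]] /=; have [c [Tc cx] qc] := step x (j + k)%N Tx.
  by exists (exist _ c Tc).
pose Y := fix Y k := if k is k'.+1 then f (k', Y k') else exist _ S TS.
pose X k := proj1_sig (Y k).
have XS k : agree (j + k) (X k.+1) (X k) by exact: (fP (k, Y k)).1.
have Xm k m i : (i <= j + k)%N -> (k <= m)%N -> X m i = X k i.
  move=> ik; elim: m => [|m IH]; first by rewrite leqn0 => /eqP->.
  rewrite leq_eqVlt => /orP[/eqP->//|km].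
  by rewrite XS ?IH// (leq_trans ik)// leq_add2l.
exists X; split => //.
- by move=> k; exact: proj2_sig.
- by move=> k; exact: (fP (k, Y k)).2.
exists (fun i => X i i).
  apply: cT => [n|n i im]; first exact: proj2_sig.
  by rewrite XS// (leq_trans im) ?leq_addl.
move=> k i ik; have [ki|ik'] := leqP k i; first exact: Xm.
by rewrite (Xm i k i) ?leq_addl// ltnW.
Qed.

(** * Shifted conditional spaces *)

Definition glue S j (x : nat -> R) i := if (i < j)%N then S i else x (i - j)%N.

(** Prefixing the past of [S] inverts the shift. The value of [glue] at date [j] is already taken
    from [x], whence the condition on [x 0]. *)
Lemma shiftedP T S j (x : nat -> R) :
  shifted T S j x <-> T (glue S j x) /\ x 0%N = S j.
Proof.
split=> [[y [Ty yS] <-]|[Tx x0]].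
  rewrite addn0 yS//; split => //.
  suff -> : glue S j (fun i => y (j + i)%N) = y by [].
  apply/funext => i; rewrite /glue; case: ltnP => ij; first by rewrite yS// ltnW.
  by rewrite subnKC.
exists (glue S j x).
  split => // i; rewrite /glue leq_eqVlt => /orP[/eqP->|->//].
  by rewrite ltnn subnn.
by apply/funext => i; rewrite /glue ltnNge leq_addr/= addKn.
Qed.

Lemma traj_set_shifted T S j : T S -> traj_set R (shifted T S j).
Proof.
move=> TS; split; first by exists (fun i => S (j + i)%N), S.
by exists (S j) => x /shiftedP[].
Qed.

Lemma complete_shifted T S j : complete R T -> complete R (shifted T S j).
Proof.
move=> cT x xT xx; apply/shiftedP; split; last first.
  by have /shiftedP[_ ->] := xT 0%N.
have -> : glue S j (fun i => x i i) = (fun i => glue S j (x (i - j)%N) i).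
  by apply/funext => i; rewrite /glue; case: ltnP.
(* Indexing by [n - j] makes the sequence in [T] constant up to [n = j], where all terms share the
   glued past. *)
apply: (cT (fun n => glue S j (x (n - j)%N))) => [n|n i in_].
  by have /shiftedP[] := xT (n - j)%N.
rewrite /glue; case: ltnP => // ji; rewrite subSn ?(leq_trans ji)// xx//.
exact: leq_sub2r.
Qed.

Lemma no_typeII_shifted T S j : no_typeII_arbitrage R T ->
  no_typeII_arbitrage R (shifted T S j).
Proof.
move=> ntII x k /shiftedP[Tx x0] [arb nflat].
(* Nodes of the shifted space at date [k] are shifts of nodes of [T] at date [j + k]; this carries
   arbitrage and flat successors back to [T]. *)
have nodeE y : node (shifted T S j) x k y <-> exists2 z, node T (glue S j x) (j + k) z &
    y = fun i => z (j + i)%N.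
  split=> [[/shiftedP[Ty y0] yx]|[z [Tz zx] ->]].
    exists (glue S j y); last first.
      by apply/funext => i; rewrite /glue ltnNge leq_addr/= addKn.
    split => // i ijk; rewrite /glue; case: ltnP => // ji.
    by rewrite yx// leq_subLR.
  split; last first.
    by move=> i ik; rewrite zx ?leq_add2l// /glue ltnNge leq_addr/= addKn.
  exists z => //; split => // i ij; rewrite zx ?(leq_trans ij) ?leq_addr// /glue.
  by move: ij; rewrite leq_eqVlt => /orP[/eqP->|->//]; rewrite ltnn subnn.
have gk : glue S j x (j + k)%N = x k by rewrite /glue ltnNge leq_addr/= addKn.
apply: (ntII (glue S j x) (j + k)%N Tx); split.
  case: arb => e [he [ge0 [y [/nodeE[z nz ->] yp]]]]; exists e; split => //; split.
    move=> z' nz'; rewrite gk -addnS; apply: (ge0 (fun i => z' (j + i)%N)).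
    by apply/nodeE; exists z'.
  by exists z; rewrite gk -addnS.
case=> z [nz zf]; apply: nflat; exists (fun i => z (j + i)%N); split.
  by apply/nodeE; exists z.
by rewrite addnS zf gk.
Qed.

End Nodes.

(** * Simple portfolios *)

Section Wealth.
Context {R : realType}.
Implicit Types (T : set (nat -> R)) (S c d : nat -> R) (j : nat) (p : sportfolio R).

Lemma pH_adapted p : adapted (pH p).
Proof.
by move=> j x y xy; congr ph; apply/funext => -[k kj]; exact: xy.
Qed.

(** The holding is 0 from maturity on, so that the wealth recursion holds at every date. *)
Definition strat p j S := if (j < pn p)%N then pH p j S else 0.

Lemma strat_adapted p : adapted (strat p).
Proof. by move=> j x y xy; rewrite /strat (pH_adapted p j x y). Qed.

Lemma wealth0 p S : wealth p 0 S = pV p.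
Proof. by rewrite /wealth min0n big_geq// addr0. Qed.

Lemma wealthS p j S :
  wealth p j.+1 S = wealth p j S + strat p j S * (S j.+1 - S j).
Proof.
rewrite /wealth /strat; case: ltnP => jn.
  by rewrite (minn_idPl jn) big_nat_recr//= addrA.
by rewrite (minn_idPr (leqW jn)) mul0r addr0.
Qed.

Lemma wealth_adapted p : adapted (wealth p).
Proof.
move=> j x y; elim: j => [|j IH] xy; first by rewrite !wealth0.
have xyj : agree j x y by exact: agreeW xy.
by rewrite !wealthS IH// (strat_adapted p j x y)// !xy.
Qed.

Lemma wealth_node p j S c : agree j c S ->
  wealth p j.+1 c = wealth p j S + strat p j S * (c j.+1 - S j).
Proof.
move=> cS; rewrite wealthS (wealth_adapted p j c S)// (strat_adapted p j c S)//.
by rewrite (cS j).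
Qed.

Lemma wealth_twealth p j S : (pn p <= j)%N -> wealth p j S = twealth p S.
Proof. by move=> jn; rewrite /twealth /wealth (minn_idPr jn) minnn. Qed.

Lemma mk_portfolio_subproof n : (0 < n.+1)%N. Proof. by []. Qed.

(** A finite history is extended to a full sequence by freezing it at date [i], which an adapted [g]
    does not notice. The maturity is [n.+1] because it must be positive. *)
Definition mk_portfolio (v : R) (n : nat) (g : nat -> (nat -> R) -> R) : sportfolio R :=
  SPortfolio R v n.+1 (mk_portfolio_subproof n)
    (fun i h => g i (fun k => h (inord (minn k i)))).

Lemma pH_mk_portfolio v n g : adapted g -> pH (mk_portfolio v n g) = g.
Proof.
move=> ag; apply/funext => i; apply/funext => S; rewrite /pH/=.
by apply: ag => k ki; rewrite (minn_idPl ki) inordK.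
Qed.

Lemma wealth_mk_portfolioS v n g j S : adapted g -> (j <= n)%N ->
  let p := mk_portfolio v n g in
  wealth p j.+1 S = wealth p j S + g j S * (S j.+1 - S j).
Proof. by move=> ag jn p; rewrite wealthS /strat ifT// pH_mk_portfolio. Qed.

Definition opp_portfolio p : sportfolio R :=
  SPortfolio R (- pV p) (pn p) (pn_gt0 p) (fun i h => - ph p i h).

Lemma wealth_opp p j S : wealth (opp_portfolio p) j S = - wealth p j S.
Proof.
elim: j => [|j IH]; first by rewrite !wealth0.
rewrite !wealthS IH [RHS]opprD -[in RHS]mulNr; congr (_ + _ * _).
by rewrite /strat/=; case: ifP; rewrite ?oppr0.
Qed.

Lemma twealth_opp p S : twealth (opp_portfolio p) S = - twealth p S.
Proof. exact: wealth_opp. Qed.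

End Wealth.

Section ConvexMix.
Context {R : realType}.

Lemma zero_weights (x y : R) : x * y < 0 -> exists a b : R,
  [/\ 0 < a, 0 < b, a + b = 1 & a * x + b * y = 0].
Proof.
wlog x0 : x y / 0 < x => [hw|].
  have [|x0] := ltP 0 x; first exact: hw.
  move=> xy; have y0 : 0 < y by rewrite ltNge; apply/negP => y0; nra.
  have [|a [b [a0 b0 ab e]]] := hw y x y0; first by rewrite mulrC.
  by exists b, a; split => //; lra.
move=> xy; have y0 : y < 0 by rewrite -(pmulr_rlt0 _ x0).
have d0 : 0 < x - y by lra.
exists (- y / (x - y)), (x / (x - y)); split; rewrite ?divr_gt0//; first lra.
  by field; lra.
by field; lra.
Qed.

End ConvexMix.

(** * Total wealth of generalized portfolios *)

Section Total.
Context {R : realType}.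
Variable T : set (nat -> R).
Hypothesis cT : complete R T.
Hypothesis ntII : no_typeII_arbitrage R T.
Implicit Types (S c d : nat -> R) (j : nat) (p : sportfolio R) (P : nat -> sportfolio R).

(** Adaptedness transfers the bound on each approximating trajectory of [limit_path] to the
    limit. *)
Lemma nonincreasing_path (phi : nat -> (nat -> R) -> \bar R) : adapted phi ->
  (forall S j, T S -> exists2 c, node T S j c & (phi j.+1 c <= phi j S)%E) ->
  forall S j, T S ->
    exists2 L, node T S j L & forall k, (j <= k)%N -> (phi k L <= phi j S)%E.
Proof.
move=> aphi step S j TS.
have [X [X0 TX XQ [L TL LX]]] :=
  limit_path T (fun j S c => (phi j.+1 c <= phi j S)%E) cT step S j TS.
have XS k : (phi (j + k)%N (X k) <= phi j S)%E.
  elim: k => [|k IH]; first by rewrite addn0 X0.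
  by rewrite addnS (le_trans (XQ k)).
exists L; first by split=> // i ij; rewrite (LX 0%N) ?addn0// X0.
by move=> k jk; rewrite -(subnKC jk) (aphi _ _ _ (LX (k - j)%N)) XS.
Qed.

(** The increment of [phi] vanishes at a flat successor and, depending on the sign of [k], is
    nonpositive at one of two opposite successors. *)
Lemma affine_path (phi k : nat -> (nat -> R) -> R) : adapted phi ->
  (forall S c j, T S -> node T S j c ->
    phi j.+1 c = phi j S + k j S * (c j.+1 - S j)) ->
  forall S j, T S ->
    exists2 L, node T S j L & forall k, (j <= k)%N -> phi k L <= phi j S.
Proof.
move=> aphi phiS S j TS.
have [|{}S {}j {}TS|L nL Lle] := nonincreasing_path (fun j S => (phi j S)%:E) _ _ S j TS.
- by move=> i x y xy; rewrite (aphi i x y).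
- case: (flat_or_opposite T S j ntII TS) => [[c nc cS]|[c [d [nc nd cS dS]]]].
    by exists c => //; rewrite (phiS S)// cS subrr mulr0 addr0.
  have [k0|k0] := leP 0 (k j S).
    by exists d => //; rewrite lee_fin (phiS S)// gerDl mulr_ge0_le0// subr_le0 ltW.
  exists c => //; rewrite lee_fin (phiS S)// gerDl mulr_le0_ge0 ?ltW//.
  by rewrite subr_gt0.
- by exists L.
Qed.

Lemma wealth_path p S j : T S ->
  exists2 L, node T S j L & twealth p L <= wealth p j S.
Proof.
move=> TS; have [|L nL Lle] := affine_path (wealth p) (strat p) (wealth_adapted p) _ S j TS.
  by move=> x c i Tx [Tc cx]; exact: wealth_node.
by exists L => //; rewrite -(wealth_twealth p (maxn j (pn p))) ?leq_maxr// Lle// leq_maxl.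
Qed.

Lemma wealth_ge0 p S j : positive_sp T p -> T S -> 0 <= wealth p j S.
Proof.
by move=> [_ pge0] TS; have [L [TL _]] := wealth_path p S j TS; exact/le_trans/pge0.
Qed.

(** Along some trajectory the difference of the two wealths never exceeds its initial value, and it
    is 0 once both maturities have passed. *)
Lemma condLOP_complete : (exists S, T S) -> condLOP R T.
Proof.
move=> [S TS].
suff le p q : (forall S, T S -> twealth p S = twealth q S) -> pV q <= pV p.
  by move=> p q e; apply/eqP; rewrite eq_le !le// => x /e.
move=> e.
have [||L [TL _] Lle] := affine_path (fun j S => wealth p j S - wealth q j S)
    (fun j S => strat p j S - strat q j S) _ _ S 0 TS.
- by move=> j x y xy; rewrite !(wealth_adapted _ j x y).
- by move=> x c j Tx [_ cx]; rewrite !(wealth_node _ _ x c)//; ring.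
have := Lle (maxn (pn p) (pn q)) (leq0n _).
rewrite !wealth0 (wealth_twealth p) ?leq_maxl// (wealth_twealth q) ?leq_maxr//.
by rewrite e// subrr subr_ge0.
Qed.

(** For a generalized portfolio, part 0 alone may be negative; the others form a series of
    nonnegative terms, possibly with sum [+oo]. *)
Definition total_wealth P j S : \bar R :=
  ((wealth (P 0%N) j S)%:E + \sum_(1 <= m <oo) (wealth (P m) j S)%:E)%E.

Lemma total_wealth_adapted P : adapted (total_wealth P).
Proof.
move=> j x y xy; rewrite /total_wealth (wealth_adapted _ j x y)//; congr (_ + _)%E.
by apply: eq_eseriesr => m _; rewrite (wealth_adapted _ j x y).
Qed.

Lemma total_wealth0 P S : total_wealth P 0 S = endowment P.
Proof.
by rewrite /total_wealth wealth0; congr (_ + _)%E; apply: eq_eseriesr => m _; rewrite wealth0.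
Qed.

Section Gen.
Variable P : nat -> sportfolio R.
Hypothesis gP : gen_portfolio T P.

Lemma tail_ge0 S j m : T S -> (1 <= m)%N -> (0 <= (wealth (P m) j S)%:E)%E.
Proof. by move=> TS m1; rewrite lee_fin wealth_ge0//; exact: gP. Qed.

Lemma total_wealth_ltNy S j : T S -> (-oo < total_wealth P j S)%E.
Proof.
move=> TS; rewrite (lt_le_trans (ltNyr (wealth (P 0%N) j S)))// leeDl//.
by apply: nneseries_ge0 => m m1 _; exact: tail_ge0.
Qed.

Lemma total_wealth_flat S c j : node T S j c -> c j.+1 = S j ->
  total_wealth P j.+1 c = total_wealth P j S.
Proof.
move=> [Tc cS] e; rewrite /total_wealth (wealth_node _ _ S)// e subrr mulr0 addr0.
congr (_ + _)%E; apply: eq_eseriesr => m _.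
by rewrite (wealth_node _ _ S)// e subrr mulr0 addr0.
Qed.

Lemma total_wealth_mix S c d j (a b : R) : T S -> node T S j c -> node T S j d ->
  0 < a -> 0 < b -> a + b = 1 -> a * (c j.+1 - S j) + b * (d j.+1 - S j) = 0 ->
  (a%:E * total_wealth P j.+1 c + b%:E * total_wealth P j.+1 d = total_wealth P j S)%E.
Proof.
move=> TS [Tc cS] [Td dS] a0 b0 ab abe.
have mix p : a * wealth p j.+1 c + b * wealth p j.+1 d = wealth p j S.
  rewrite !(wealth_node p j S)//.
  transitivity ((a + b) * wealth p j S +
      strat p j S * (a * (c j.+1 - S j) + b * (d j.+1 - S j))); first ring.
  by rewrite ab abe mulr0 addr0 mul1r.
have ge0 x : T x -> (0 <= \sum_(1 <= m <oo) (wealth (P m) j.+1 x)%:E)%E.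
  by move=> Tx; apply: nneseries_ge0 => m m1 _; exact: tail_ge0.
have Zl (r : R) x : T x -> (r%:E * \sum_(1 <= m <oo) (wealth (P m) j.+1 x)%:E =
    \sum_(1 <= m <oo) (r%:E * (wealth (P m) j.+1 x)%:E))%E.
  move=> Tx; rewrite eseries_cond [RHS]eseries_cond nneseriesZl// => m /= m1.
  exact: tail_ge0.
rewrite /total_wealth !muleDr ?fin_num_adde_defr// -!EFinM !Zl// addeACA -EFinD mix.
congr (_ + _)%E; rewrite -nneseriesD.
- by apply: eq_eseriesr => m _; rewrite -!EFinM -EFinD mix.
- by move=> m m1 _; rewrite mule_ge0 ?lee_fin ?(ltW a0)// -lee_fin tail_ge0.
- by move=> m m1 _; rewrite mule_ge0 ?lee_fin ?(ltW b0)// -lee_fin tail_ge0.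
Qed.

Lemma total_wealth_step S j : T S ->
  exists2 c, node T S j c & (total_wealth P j.+1 c <= total_wealth P j S)%E.
Proof.
move=> TS; case: (flat_or_opposite T S j ntII TS) => [[c nc cS]|[c [d [nc nd cS dS]]]].
  by exists c => //; rewrite (total_wealth_flat S).
have /zero_weights[a [b [a0 b0 ab abe]]] : (c j.+1 - S j) * (d j.+1 - S j) < 0.
  by rewrite pmulr_rlt0 ?subr_gt0// subr_lt0.
have mix := total_wealth_mix S c d j a b TS nc nd a0 b0 ab abe.
have [h|h] := leP (total_wealth P j.+1 c) (total_wealth P j S); first by exists c.
exists d => //; rewrite leNgt; apply/negP => h'.
have := total_wealth_ltNy S j TS; move: mix h h'.
have := total_wealth_ltNy c j.+1 nc.1; have := total_wealth_ltNy d j.+1 nd.1.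
(* An infinite value at either successor makes the mean infinite, against [h]; finite values both
   above [z] cannot have mean [z]. *)
case: (total_wealth P j.+1 c) => [x||]//; case: (total_wealth P j.+1 d) => [y||]//;
  case: (total_wealth P j S) => [z||]//.
- move=> _ _ + + + _; rewrite -!EFinM -EFinD !lte_fin => -[e] zx zy.
  have : a * z + b * z = z by rewrite -mulrDl ab mul1r.
  have : a * z < a * x by rewrite ltr_pM2l.
  have : b * z < b * y by rewrite ltr_pM2l.
  lra.
- by move=> _ _; rewrite gt0_muley ?lte_fin// -EFinM.
- by move=> _ _; rewrite gt0_muley ?lte_fin// -EFinM.
- by move=> _ _; rewrite !gt0_muley ?lte_fin.
Qed.

(** Maturities may be unbounded, so no date need be terminal for all parts: each partial sum is
    bounded at a date past its own maturities, then the limit is taken. *)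
Lemma total_wealth_path S j : T S -> exists2 L, node T S j L &
  ((twealth (P 0%N) L)%:E + \sum_(1 <= m <oo) (twealth (P m) L)%:E
    <= total_wealth P j S)%E.
Proof.
move=> TS; have [L nL Lle] := nonincreasing_path (total_wealth P)
  (total_wealth_adapted P) (fun S j => total_wealth_step S j) S j TS.
exists L => //; rewrite -leeBrDl//; apply: lime_le.
  by apply: is_cvg_nneseries => m m1 _; rewrite lee_fin; exact: (gP m m1).2 L nL.1.
apply: nearW => M; rewrite leeBrDl//.
pose K := maxn j (\max_(i < M.+1) pn (P i)).
have PK m : (m <= M)%N -> (pn (P m) <= K)%N.
  by move=> mM; rewrite leq_max (leq_bigmax (Ordinal (mM : (m < M.+1)%N))) orbT.
apply: le_trans (Lle K (leq_maxl _ _)); rewrite /total_wealth wealth_twealth ?PK//.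
rewrite leeD2l//; apply: le_trans; last first.
  by apply: (nneseries_lim_ge M) => m m1 _; exact: tail_ge0 nL.1 m1.
rewrite big_nat_cond [leRHS]big_nat_cond; apply: lee_sum => m; rewrite andbT => /andP[_ mM].
by rewrite wealth_twealth// PK// ltnW.
Qed.

Lemma superhedge_total_wealth (g : (nat -> R) -> R) n S j :
  (forall x y, agree n x y -> g x = g y) -> superhedges T P g ->
  T S -> (n <= j)%N -> ((g S)%:E <= total_wealth P j S)%E.
Proof.
move=> ag hg TS nj; have [L [TL LS] Lle] := total_wealth_path S j TS.
by rewrite -(ag L S) ?(le_trans (hg L TL))//; exact: agreeW LS.
Qed.

Lemma superhedge_total_wealth_ge0 (g : (nat -> R) -> R) S j :
  (forall x, 0 <= g x) -> superhedges T P g -> T S -> (0 <= total_wealth P j S)%E.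
Proof.
move=> g0 hg TS; have [L [TL LS] Lle] := total_wealth_path S j TS.
by apply: le_trans (le_trans (hg L TL) Lle); rewrite lee_fin.
Qed.

(** * Replication of the total wealth by one simple portfolio *)

Section Replication.
Hypothesis endow_fin : endowment P \is a fin_num.

Lemma opposite_fin_num S c d j : T S -> node T S j c -> node T S j d ->
  (c j.+1 - S j) * (d j.+1 - S j) < 0 -> total_wealth P j S \is a fin_num ->
  total_wealth P j.+1 c \is a fin_num.
Proof.
move=> TS nc nd /zero_weights[a [b [a0 b0 ab abe]]].
rewrite -(total_wealth_mix S c d j a b TS nc nd a0 b0 ab abe).
have := total_wealth_ltNy c j.+1 nc.1; have := total_wealth_ltNy d j.+1 nd.1.
case: (total_wealth P j.+1 c) => [x||]//; case: (total_wealth P j.+1 d) => [y||]//.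
- by rewrite gt0_muley ?lte_fin// -EFinM.
- by rewrite !gt0_muley ?lte_fin.
Qed.

(** Equality of two slopes, cleared of denominators: the changes of total wealth and of price have
    mean 0 under the same weights. *)
Lemma slope_opposite S c d j : T S -> node T S j c -> node T S j d ->
  (c j.+1 - S j) * (d j.+1 - S j) < 0 -> total_wealth P j S \is a fin_num ->
  let t := fun x => fine (total_wealth P j.+1 x) in let z := fine (total_wealth P j S) in
  (t c - z) * (d j.+1 - S j) = (t d - z) * (c j.+1 - S j).
Proof.
move=> TS nc nd cd fS t z.
have /fineK fc := opposite_fin_num S c d j TS nc nd cd fS.
have /fineK fd : total_wealth P j.+1 d \is a fin_num.
  by apply: opposite_fin_num fS => //; [exact: nc|rewrite mulrC].
have [a [b [a0 b0 ab abe]]] := zero_weights _ _ cd.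
have := total_wealth_mix S c d j a b TS nc nd a0 b0 ab abe.
rewrite -fc -fd -(fineK fS) -!EFinM -EFinD => -[]; rewrite -/(t c) -/(t d) -/z => e.
apply: (mulfI (lt0r_neq0 a0)).
have -> : z = a * z + b * z by rewrite -mulrDl ab mul1r.
move: e abe; have -> : b = 1 - a by rewrite -ab addrAC subrr add0r.
set x := c _ - _; set y := d _ - _ => e abe.
have e1 : a * x = - ((1 - a) * y) by apply/eqP; rewrite -addr_eq0 abe.
transitivity (y * (a * t c - a * z)); first by ring.
have -> : a * t c - a * z = - ((1 - a) * t d - (1 - a) * z).
  apply/eqP; rewrite -addr_eq0; apply/eqP.
  by transitivity (a * t c + (1 - a) * t d - z); [ring|rewrite e subrr].
transitivity ((t d - z) * (a * x)); last by ring.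
by rewrite e1; ring.
Qed.

(** The holdings that replicate the next change of total wealth. They form a set because there may
    be none, or many, as when all successors are flat. *)
Definition slopes j S := [set k : R | forall c, node T S j c ->
  (total_wealth P j.+1 c = total_wealth P j S + (k * (c j.+1 - S j))%:E)%E].

Lemma slopes_adapted : adapted slopes.
Proof.
move=> j x y xy; rewrite /slopes (node_agree T j x y xy).
by rewrite (total_wealth_adapted P j x y xy) (xy j).
Qed.

Lemma slopes_nonempty S j : T S -> ~ arbitrage_node T S j ->
  total_wealth P j S \is a fin_num -> exists k, slopes j S k.
Proof.
move=> TS narb fS.
have [[c0 nc0 c0S]|flat] := pselect (exists2 c, node T S j c & c j.+1 != S j); last first.
  exists 0 => c nc; rewrite mul0r adde0 (total_wealth_flat S)//.
  by apply/eqP; apply: contrapT => /negP cS; apply: flat; exists c.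
have [d0 nd0 cd0] := opposite_move _ _ _ _ narb nc0 c0S.
pose t x := fine (total_wealth P j.+1 x); pose z := fine (total_wealth P j S).
exists ((t c0 - z) / (c0 j.+1 - S j)) => c nc.
have [cS|cS] := eqVneq (c j.+1) (S j).
  by rewrite cS subrr mulr0 adde0 (total_wealth_flat S).
have [d nd cd] := opposite_move _ _ _ _ narb nc cS.
have /fineK <- := opposite_fin_num S c d j TS nc nd cd fS.
rewrite -(fineK fS) -EFinD -/(t c) -/z; congr EFin.
have c0S' : c0 j.+1 - S j != 0 by rewrite subr_eq0.
have d0S' : d0 j.+1 - S j != 0.
  by apply/eqP => e; move: cd0; rewrite e mulr0 ltxx.
suff e : (t c - z) * (c0 j.+1 - S j) = (t c0 - z) * (c j.+1 - S j).
  by rewrite mulrAC -e mulfK// addrC subrK.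
(* A move opposite to that of [c0] is compared with it directly; a move on the same side is compared
   through [d0], which is opposite to both. *)
have [cc0|cc0] := ltP ((c j.+1 - S j) * (c0 j.+1 - S j)) 0.
  exact: slope_opposite.
have cd0' : (c j.+1 - S j) * (d0 j.+1 - S j) < 0.
  have [x0|x0] := ltP 0 (c0 j.+1 - S j).
    have y0 : d0 j.+1 - S j < 0 by rewrite -(pmulr_rlt0 _ x0).
    rewrite nmulr_llt0// lt_neqAle eq_sym subr_eq0 cS/=.
    by rewrite -(pmulr_lge0 _ x0).
  have {}x0 : c0 j.+1 - S j < 0 by rewrite lt_neqAle c0S'.
  have y0 : 0 < d0 j.+1 - S j by rewrite -(nmulr_rlt0 _ x0).
  rewrite pmulr_llt0// lt_neqAle subr_eq0 cS/=.
  by rewrite -(nmulr_lge0 _ x0).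
apply: (mulIf d0S').
have := slope_opposite S c0 d0 j TS nc0 nd0 cd0 fS.
have := slope_opposite S c d0 j TS nc nd0 cd0' fS.
rewrite -/(t c) -/(t c0) -/(t d0) -/z => e1 e2.
by rewrite mulrAC e1 [RHS]mulrAC e2; ring.
Qed.

Definition good j S := forall i, (i < j)%N -> arbitrage_node T S i -> S i.+1 = S i.

Lemma good_adapted : adapted good.
Proof.
suff le j x y : agree j x y -> good j x -> good j y.
  move=> j x y xy; apply/propext; split; apply: le => //; exact: agree_sym.
move=> xy gx i ij; have xyi : agree i x y := agreeW _ _ _ _ (ltnW ij) xy.
rewrite -(arbitrage_node_adapted T i x y xyi) => /(gx i ij).
by rewrite !xy// ltnW.
Qed.

(** Each move of a good trajectory is flat or leaves a node that is not an arbitrage node, hence has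
    an opposite move; either way finiteness propagates from the endowment. *)
Lemma good_fin_num S j : T S -> good j S -> total_wealth P j S \is a fin_num.
Proof.
move=> TS; elim: j => [|j IH] gj; first by rewrite total_wealth0.
have fS : total_wealth P j S \is a fin_num by apply: IH => i ij; apply: gj; exact: ltnW.
have nS : node T S j S by [].
have [e|ne] := eqVneq (S j.+1) (S j); first by rewrite (total_wealth_flat S).
have narb : ~ arbitrage_node T S j by move=> /(gj _ (leqnn _)) /eqP; rewrite (negPf ne).
have [d nd cd] := opposite_move _ _ _ _ narb nS ne.
exact: opposite_fin_num cd fS.
Qed.

(* The slope of the total wealth is well defined as long as the trajectory has
   made no nonzero move out of an arbitrage node; after such a move the
   investor holds nothing, its losses being covered by [arbitrage_sign]. *)
Definition hedge j S : R :=
  if `[< good j S /\ ~ arbitrage_node T S j >] then xget 0 (slopes j S) else 0.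

Lemma hedge_adapted : adapted hedge.
Proof.
move=> j x y xy; rewrite /hedge (good_adapted j x y xy) (slopes_adapted j x y xy).
by rewrite (arbitrage_node_adapted T j x y xy).
Qed.

(** While the trajectory is good, the hedge equals the total wealth, nonnegative since [g] is
    superhedged; afterwards it keeps its last value. *)
Lemma wealth_hedge (g : (nat -> R) -> R) n S j : (forall x, 0 <= g x) ->
  superhedges T P g -> T S -> (j <= n.+1)%N ->
  let D := mk_portfolio (fine (endowment P)) n hedge in
  0 <= wealth D j S /\ (good j S -> (wealth D j S)%:E = total_wealth P j S).
Proof.
move=> g0 hg TS jn D; elim: j jn => [|j IH] jn.
  rewrite wealth0/= fineK// total_wealth0; split => //.
  by rewrite -lee_fin fineK// -(total_wealth0 P S) (superhedge_total_wealth_ge0 g).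
have [ge0 eqj] := IH (ltnW jn).
rewrite [wealth D _ _](wealth_mk_portfolioS _ _ _ _ _ hedge_adapted)//.
rewrite -/D /hedge; case: asboolP => [[gj narb]|ngood]; last first.
  (* The holding is 0 here. If the trajectory is still good, it made a flat move out of an arbitrage
     node, and the total wealth is unchanged too. *)
  rewrite mul0r addr0; split => // gj1.
  have gj : good j S by move=> i ij; apply: gj1; exact: ltnW.
  have arb : arbitrage_node T S j by apply: contrapT => narb; exact: ngood.
  by rewrite eqj// (total_wealth_flat S)//; exact: gj1.
have /cid[k kP] := slopes_nonempty S j TS narb (good_fin_num S j TS gj).
have e : ((wealth D j S + xget 0 (slopes j S) * (S j.+1 - S j))%:E = total_wealth P j.+1 S)%E.
  by rewrite EFinD eqj// ((xgetPex 0 (ex_intro _ k kP)) S).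
by split => //; rewrite -lee_fin e (superhedge_total_wealth_ge0 g).
Qed.

End Replication.
End Gen.

(** * Betting on arbitrage nodes *)

Definition arbitrage_sign j S : R :=
  if `[< forall c, node T S j c -> S j <= c j.+1 >] then 1
  else if `[< forall c, node T S j c -> c j.+1 <= S j >] then -1 else 0.

Lemma arbitrage_sign_adapted : adapted arbitrage_sign.
Proof.
move=> j x y xy; rewrite /arbitrage_sign (node_agree T j x y xy).
by rewrite (xy j).
Qed.

Lemma arbitrage_sign_ge0 S j : T S -> 0 <= arbitrage_sign j S * (S j.+1 - S j).
Proof.
move=> TS; have nS : node T S j S by [].
rewrite /arbitrage_sign; case: asboolP => [/(_ _ nS)|_]; first by rewrite mul1r subr_ge0.
case: asboolP => [/(_ _ nS)|_]; last by rewrite mul0r.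
by rewrite mulN1r oppr_ge0 subr_le0.
Qed.

Lemma arbitrage_sign_gt0 S j : T S -> arbitrage_node T S j -> S j.+1 != S j ->
  0 < arbitrage_sign j S * (S j.+1 - S j).
Proof.
move=> TS arb ne; rewrite lt_neqAle arbitrage_sign_ge0// andbT eq_sym mulf_neq0//.
  rewrite /arbitrage_sign; case: asboolP => h1; first exact: oner_neq0.
  case: asboolP => h2; first by rewrite oppr_eq0 oner_neq0.
  case: arb => e [[]-> [ge0 _]].
    by exfalso; apply: h1 => c /ge0; rewrite mul1r subr_ge0.
  by exfalso; apply: h2 => c /ge0; rewrite mulN1r oppr_ge0 subr_le0.
by rewrite subr_eq0.
Qed.

(** The bet never loses, and the first nonzero move out of an arbitrage node brings a strict gain
    that later dates cannot undo. *)
Lemma wealth_arbitrage_sign n S j : T S -> (j <= n.+1)%N ->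
  let G := mk_portfolio 0 n arbitrage_sign in
  0 <= wealth G j S /\ (~ good j S -> 0 < wealth G j S).
Proof.
move=> TS jn G; elim: j jn => [|j IH] jn; first by rewrite wealth0; split => // -[].
have [ge0 gt0] := IH (ltnW jn).
rewrite [wealth G _ _](wealth_mk_portfolioS _ _ _ _ _ arbitrage_sign_adapted)// -/G.
have inc := arbitrage_sign_ge0 S j TS.
split; first by rewrite addr_ge0.
move=> ng; have [gj|] := pselect (good j S); last by move=> /gt0 w0; rewrite ltr_pwDl.
rewrite ltr_wpDl//; apply: arbitrage_sign_gt0 => //.
- apply: contrapT => narb; apply: ng => i; rewrite ltnS leq_eqVlt => /orP[/eqP->//|].
  exact: gj.
- apply/eqP => e; apply: ng => i; rewrite ltnS leq_eqVlt => /orP[/eqP->//|].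
  exact: gj.
Qed.

(** The superhedge is made positive at equal cost: on good trajectories [D] equals the total wealth
    at date [n.+1], and copies of [G] cover the others. *)
Lemma Ibar_le_endowment P (g : (nat -> R) -> R) n : (exists S, T S) ->
  (forall x, 0 <= g x) -> (forall x y, agree n x y -> g x = g y) ->
  gen_portfolio T P -> superhedges T P g -> (Ibar R T g <= endowment P)%E.
Proof.
move=> [S0 TS0] g0 ag gP hg.
have e0 : (0 <= endowment P)%E.
  by rewrite -(total_wealth0 P S0) (superhedge_total_wealth_ge0 P gP g).
have [->|ey] := eqVneq (endowment P) +oo%E; first exact: leey.
have efin : endowment P \is a fin_num by rewrite ge0_fin_numE// ltey.
pose D := mk_portfolio (fine (endowment P)) n (hedge P).
pose G := mk_portfolio 0 n arbitrage_sign.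
pose Z := mk_portfolio 0 0 (fun _ (_ : nat -> R) => 0).
(* Infinitely many copies of the costless portfolio [G] pay [+oo] on every
   trajectory that has left an arbitrage node by a nonzero move. *)
pose P' m := if m is m'.+1 then if m' is 0%N then D else G else Z.
have wZ j S : wealth Z j S = 0.
  elim: j => [|j IH]; first by rewrite wealth0.
  by rewrite wealthS IH /strat pH_mk_portfolio//; case: ifP; rewrite mul0r addr0.
have D0 S : T S -> 0 <= twealth D S.
  by move=> TS; apply: (wealth_hedge P gP efin g n S n.+1 g0 hg TS (leqnn _)).1.
have G0 S : T S -> 0 <= twealth G S.
  by move=> TS; apply: (wealth_arbitrage_sign n S n.+1 TS (leqnn _)).1.
have gP' : gen_portfolio T P'.
  by case=> [//|[|m] _]; split => //=; exact: fine_ge0.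
have tail0 S m : T S -> (1 <= m)%N -> (0 <= (twealth (P' m) S)%:E)%E.
  by move=> TS m1; rewrite lee_fin; exact: (gP' m m1).2.
apply: ereal_inf_lbound; exists P'; last first.
  rewrite /endowment/= add0e (nneseries_split 1 1)/=; last first.
    by move=> m m1; rewrite lee_fin; exact: (gP' m m1).1.
  by rewrite big_nat1 fineK// eseries0 ?adde0// => -[//|[|m]].
split; first by split.
move=> S TS; rewrite /twealth wZ add0e -/twealth.
have [gS|nS] := pselect (good n.+1 S).
  apply: (@le_trans _ _ (twealth D S)%:E).
    have [_ ->//] := wealth_hedge P gP efin g n S n.+1 g0 hg TS (leqnn _).
    exact: (superhedge_total_wealth P gP g n).
  apply: le_trans; last by apply: (nneseries_lim_ge 2) => m m1 _; exact: tail0.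
  by rewrite big_nat1.
have [_ /(_ nS) w0] := wealth_arbitrage_sign n S n.+1 TS (leqnn _).
(* [M.+1] copies of [G] cover [g S]; the partial sum below [M.+3] consists of [D] at index 1 and
   exactly these copies. *)
pose M := Num.truncn (g S / twealth G S).
apply: le_trans; last by apply: (nneseries_lim_ge M.+3) => m m1 _; exact: tail0.
rewrite big_ltn// -[leLHS]add0e leeD//; first by rewrite lee_fin D0.
rewrite big_nat (eq_bigr (fun=> (twealth G S)%:E)); last by move=> [//|[|m]].
rewrite -big_nat sumEFin lee_fin sumr_const_nat -mulr_natl.
rewrite -ler_pdivrMr// subSS subSS subn0 ltW// truncnS_gt//.
Qed.

(** * Properties (L) and (K) *)

Lemma condL_complete : (exists S, T S) -> condL R T.
Proof.
move=> [S TS]; apply: le_ereal_inf_tmp => _ [P [gP hP] <-].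
rewrite -(total_wealth0 P S) (superhedge_total_wealth_ge0 P gP (fun=> 0))//.
Qed.

Lemma condK_complete : (exists S, T S) -> condK R T.
Proof.
move=> exS p; have [S TS] := exS.
apply: le_ereal_inf_tmp => _ [P [[gP P0] hP] <-].
pose P' m := if m is 0%N then opp_portfolio p else P m.
have P00 : pV (P 0%N) = 0 by rewrite -(wealth0 _ S) P0.
have -> : endowment P = ((pV p)%:E + endowment P')%E.
  rewrite /endowment P00 add0e/= addeA -EFinD subrr add0e.
  by rewrite eseries_cond [RHS]eseries_cond; apply: eq_eseriesr => -[].
rewrite leeD2l//; apply: (Ibar_le_endowment _ _ (pn p)) => //.
- by move=> x; rewrite le_max lexx orbT.
- move=> x y xy; congr (Num.max (- _) _).
  exact: wealth_adapted.
- by case=> [//|m]; exact: gP.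
- move=> x Tx; rewrite /= twealth_opp.
  have := hP x Tx; rewrite /twealth P0// add0e -/twealth => h.
  (* The new part 0 supplies the first summand, the tail of [P] the second. *)
  have -> : Num.max (- twealth p x) 0 = - twealth p x + Num.max (twealth p x) 0.
    by rewrite addr_maxr addNr addr0 maxC.
  rewrite EFinD leeD2l// (le_trans h)//.
  by rewrite eseries_cond [leRHS]eseries_cond le_eqVlt; apply/orP; left; apply/eqP;
     apply: eq_eseriesr => -[].
Qed.

End Total.

(** * The martingale measure *)

Section Splitting.
Context {R : realType}.
Variable T : set (nat -> R).
Hypothesis cT : complete R T.
Variables (s0 : nat -> R) (hs0 : T s0).
Let traj := {S : nat -> R | T S}.
(** [up] and [dn] may coincide, which covers flat successors; weights strictly between 0 and 1 keep
    every interval nondegenerate. *)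
Variables (up dn : nat -> traj -> traj) (al : nat -> traj -> R).
Hypothesis up_agree : forall j x, agree j (sval (up j x)) (sval x).
Hypothesis dn_agree : forall j x, agree j (sval (dn j x)) (sval x).
Hypothesis al_gt0 : forall j x, 0 < al j x.
Hypothesis al_lt1 : forall j x, al j x < 1.
Hypothesis al_mean : forall j x,
  al j x * sval (up j x) j.+1 + (1 - al j x) * sval (dn j x) j.+1 = sval x j.

(* A trajectory through the current node, followed by the end points of the
   half-open subinterval of [0, 1) attached to that node. *)
Let state := (traj * R * R)%type.

Let mid j (v : state) := v.1.2 + al j v.1.1 * (v.2 - v.1.2).

Let lower j (v : state) : state := (up j v.1.1, v.1.2, mid j v).
Let upper j (v : state) : state := (dn j v.1.1, mid j v, v.2).

(** Tracks the cell of [w] after [j] splittings. Points outside [0, 1) follow the extreme cells and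
    will carry no mass. *)
Fixpoint run (w : R) (j : nat) : state :=
  if j is i.+1 then
    (if w < mid i (run w i) then lower else upper) i (run w i)
  else (exist _ s0 hs0, 0, 1).

Definition node_traj w j : nat -> R := sval (run w j).1.1.
Definition lo w j : R := (run w j).1.2.
Definition hi w j : R := (run w j).2.

Lemma node_traj_agree w j k : (j <= k)%N -> agree j (node_traj w k) (node_traj w j).
Proof.
elim: k => [|k IH]; first by rewrite leqn0 => /eqP->.
rewrite leq_eqVlt => /orP[/eqP->//|jk]; apply: (agree_trans _ _ (node_traj w k)); last exact: IH.
apply: (agreeW j k) => //; rewrite /node_traj/=.
by case: ifP => _; [exact: up_agree|exact: dn_agree].
Qed.

Definition path_of w i := node_traj w i i.

Lemma path_of_traj w : T (path_of w).
Proof.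
apply: cT => [n|n i in_]; first exact: proj2_sig.
by rewrite (node_traj_agree w n n.+1).
Qed.

Lemma path_of_agree w j : agree j (path_of w) (node_traj w j).
Proof. by move=> i ij; rewrite /path_of -(node_traj_agree w i j ij). Qed.

Lemma finite_run j : finite_set (range (fun w => run w j)).
Proof.
elim: j => [|j IH]; first by apply: (sub_finite_set _ (finite_set1 (run 0 0%N))) => _ [w _ <-].
apply: (@sub_finite_set _ _ ([set lower j v | v in range (fun w => run w j)] `|`
                             [set upper j v | v in range (fun w => run w j)])).
  by move=> _ [w _ <-] /=; case: ifP => _; [left|right]; exists (run w j) => //; exists w.
by rewrite finite_setU; split; exact: finite_image.
Qed.

Lemma bounded_run j (h : state -> R) : exists M, forall w, `|h (run w j)| <= M.
Proof.
have /finite_seqP[s sP] := finite_image h (finite_run j).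
have {}sP w : h (run w j) \in s.
  by have : [set` s] (h (run w j)) by rewrite -sP; exists (run w j) => //; exists w.
suff [M MP] : exists M, forall y, y \in s -> `|y| <= M by exists M => w; exact: MP.
elim: s {sP} => [|y s [M MP]]; first by exists 0.
exists (Num.max `|y| M) => z; rewrite inE => /orP[/eqP->|/MP]; rewrite le_max ?lexx//.
by move=> ->; rewrite orbT.
Qed.

(** States carry no sigma-algebra, so [F] is arbitrary; by induction this makes [mid] measurable
    along the run, hence also the test that splits a cell. *)
Lemma measurable_run j (F : set state) : measurable ((fun w : R => run w j) @^-1` F).
Proof.
elim: j F => [|j IH] F.
  have [F0|nF0] := pselect (F (run 0 0%N)).
    by rewrite (_ : _ @^-1` _ = setT)//; apply/seteqP; split.
  by rewrite (_ : _ @^-1` _ = set0)//; apply/seteqP; split.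
have mm : measurable_fun [set: R] (fun w => mid j (run w j)).
  by move=> _ B mB; rewrite setTI; exact: (IH (mid j @^-1` B)).
have ml : measurable [set w : R | w < mid j (run w j)].
  have := measurable_funB mm (@measurable_id _ _ setT).
  move=> /(_ measurableT _ (measurable_itv `]0, +oo[)); rewrite setTI.
  by congr measurable; apply/seteqP; split => w /=; rewrite in_itv/= andbT subr_gt0.
rewrite (_ : _ @^-1` _ =
    ([set w : R | w < mid j (run w j)] `&` (fun w => run w j) @^-1` (lower j @^-1` F)) `|`
    (~` [set w : R | w < mid j (run w j)] `&` (fun w => run w j) @^-1` (upper j @^-1` F))).
  by apply: measurableU; apply: measurableI => //; exact: measurableC.
apply/seteqP; split => w /=.
  by case: ifPn => [wm|/negP wm] Fw; [left|right].
by case=> -[wm Fw]; [rewrite wm|rewrite ifN//; exact/negP].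
Qed.

Lemma measurable_fun_run j (h : state -> R) : measurable_fun [set: R] (fun w => h (run w j)).
Proof. by move=> _ B mB; rewrite setTI; exact: (measurable_run j (h @^-1` B)). Qed.

Lemma mid_between j (v : state) : v.1.2 < v.2 -> v.1.2 < mid j v < v.2.
Proof.
rewrite /mid => lv; have := al_gt0 j v.1.1; have := al_lt1 j v.1.1.
move: (al j v.1.1) => a a1 a0; apply/andP; split; nra.
Qed.

Lemma lo_hi w j : [/\ 0 <= lo w j, lo w j < hi w j & hi w j <= 1].
Proof.
rewrite /lo /hi; elim: j => [|j [l0 lh h1]] /=; first by split.
have /andP[lm mh] := mid_between j _ lh.
case: ifP => _ /=; split => //.
- exact: le_trans (ltW mh) _.
- exact: le_trans (ltW lm).
Qed.

(** A point in the cell of [w] has passed the same tests as [w]. *)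
Lemma run_eq w w' j : lo w j <= w' < hi w j -> run w' j = run w j.
Proof.
elim: j => //= j IH; rewrite /lo /hi/=; have [_ lh _] := lo_hi w j.
have /andP[lm mh] := mid_between j _ lh.
case: ifPn => wm /= /andP[h1 h2].
  rewrite IH; first by rewrite h2.
  by rewrite h1 (lt_trans h2).
rewrite IH; first by rewrite ltNge h1.
by rewrite h2 andbT (le_trans (ltW lm)).
Qed.

(** * Price increments under the uniform measure *)

Definition unif : probability (measurableTypeR R) R := uniform_prob (@ltr01 R).

Lemma unif_itv (a b : R) : 0 <= a -> a <= b -> b <= 1 -> unif `[a, b[%classic = (b - a)%:E.
Proof.
move=> a0 ab b1; rewrite /unif/= /uniform_prob.
rewrite (eq_integral (fun=> 1%:E)); last first.
  move=> x; rewrite inE/= in_itv/= => /andP[ax xb].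
  by rewrite /uniform_pdf (le_trans a0 ax) (ltW (lt_le_trans xb b1))/= subr0 invr1.
rewrite integral_cst//= mul1e lebesgue_measure_itv/= lte_fin.
by case: ltP => // ba; rewrite (le_anti (introT andP (conj ab ba))) subrr.
Qed.

Let incr j w := path_of w j.+1 - path_of w j.

Lemma incrE j w : incr j w = (fun v : state => sval v.1.1 j.+1 - sval v.1.1 j) (run w j.+1).
Proof. by rewrite /incr (path_of_agree w j.+1 j.+1)// (path_of_agree w j.+1 j). Qed.

Lemma measurable_incr j : measurable_fun [set: R] (incr j).
Proof.
rewrite (funext (incrE j)).
exact: (measurable_fun_run j.+1 (fun v => sval v.1.1 j.+1 - sval v.1.1 j)).
Qed.

Let cell w j : set R := `[lo w j, hi w j[%classic.

Lemma cell0 w : cell w 0 = `[0, 1[%classic. Proof. by []. Qed.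

Lemma cell_split w j : let m := mid j (run w j) in
  cell w j = `[lo w j, m[%classic `|` `[m, hi w j[%classic.
Proof.
move=> m; have [_ lh _] := lo_hi w j; have /andP[lm mh] := mid_between j _ lh.
apply/seteqP; split => x; rewrite /cell/= !in_itv/=.
  by move=> /andP[lx xh]; case: (ltP x m) => xm; [left; rewrite lx|right].
move=> [/andP[lx xm]|/andP[mx xh]]; first by rewrite lx (lt_trans xm).
by rewrite xh andbT (le_trans (ltW lm)).
Qed.

Lemma integral_cell_split w j (C : set R) (g : R -> R) : measurable C ->
  measurable_fun [set: R] g -> let m := mid j (run w j) in
  (\int[unif]_(x in cell w j `&` C) (g x)%:E =
   \int[unif]_(x in `[lo w j, m[%classic `&` C) (g x)%:E +
   \int[unif]_(x in `[m, hi w j[%classic `&` C) (g x)%:E)%E.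
Proof.
move=> mC mg m; rewrite (cell_split w j) -/m setIUl integral_setU//.
- exact: measurableI.
- exact: measurableI.
- by apply/measurable_EFinP; exact: measurable_funTS.
- apply/disj_setPS => x [[/= + _] [+ _]]; rewrite !in_itv/= => /andP[_ xm] /andP[mx _].
  by move: (lt_le_trans xm mx); rewrite ltxx.
Qed.

Lemma integral_cell_cst (a b r : R) (g : R -> R) : 0 <= a -> a <= b -> b <= 1 ->
  (forall x, a <= x < b -> g x = r) ->
  (\int[unif]_(x in `[a, b[%classic) (g x)%:E = (r * (b - a))%:E)%E.
Proof.
move=> a0 ab b1 gr; rewrite (eq_integral (fun=> r%:E)); last first.
  by move=> x; rewrite inE/= in_itv/= => /gr->.
by rewrite integral_cst//= unif_itv.
Qed.

(** Induction on the delay [k]. At 0 the increment is constant on the two subcells, whose lengths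
    are in the proportions of [al_mean]; otherwise the cell is replaced by its subcells. *)
Lemma integral_incr_cell w i k (F : set state) :
  (\int[unif]_(x in cell w i `&` (fun x => run x (i + k)) @^-1` F)
     (incr (i + k) x)%:E = 0)%E.
Proof.
elim: k i w => [|k IH] i w; rewrite ?addn0; have [l0 lh h1] := lo_hi w i;
  have /andP[lm mh] := mid_between i _ lh; have mg := measurable_incr.
- have [Fw|nFw] := pselect (F (run w i)); last first.
    rewrite (_ : _ `&` _ = set0) ?integral_set0//; apply/seteqP; split => // x [].
    by rewrite /cell/= in_itv/= => /run_eq->.
  rewrite (_ : _ `&` _ = cell w i `&` setT); last first.
    rewrite setIT; apply/seteqP; split => [x []//|x cx]; split => //=.
    by move: cx; rewrite /cell/= in_itv/= => /run_eq->.
  rewrite integral_cell_split// !setIT.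
  pose x := (run w i).1.1; set m := mid i (run w i).
  rewrite (integral_cell_cst _ _ (sval (up i x) i.+1 - sval x i))//; last 3 first.
  + exact: ltW.
  + exact: le_trans (ltW mh) h1.
  + move=> y /andP[ly ym]; have ye : run y i = run w i.
      by apply: run_eq; rewrite ly (lt_trans ym).
    by rewrite incrE/= ye ym/= (up_agree i x i).
  rewrite (integral_cell_cst _ _ (sval (dn i x) i.+1 - sval x i))//; last 3 first.
  + exact: le_trans (ltW lm).
  + exact: ltW.
  + move=> y /andP[my yh]; have ye : run y i = run w i.
      by apply: run_eq; rewrite yh (le_trans (ltW lm)).
    by rewrite incrE/= ye ltNge my/= (dn_agree i x i).
  rewrite -EFinD; congr EFin; rewrite -(al_mean i x) /m /mid -/x -/(lo w i) -/(hi w i).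
  ring.
- rewrite integral_cell_split//; last exact: measurable_run.
  set m := mid i (run w i).
  (* The left end points [lo w i] and [m] represent the two subcells. *)
  have le_ : run (lo w i) i = run w i by apply: run_eq; rewrite lexx.
  have me : run m i = run w i by apply: run_eq; rewrite (ltW lm).
  rewrite -addSnnS.
  have -> : `[lo w i, m[%classic = cell (lo w i) i.+1.
    by rewrite /cell /lo /hi/= -/(lo w i) le_ lm.
  have -> : `[m, hi w i[%classic = cell m i.+1.
    by rewrite /cell /lo /hi/= me -/m ltxx.
  by rewrite !IH adde0.
Qed.

Lemma integral_incr j (F : set state) :
  (\int[unif]_(x in (fun x => run x j) @^-1` F) (incr j x)%:E = 0)%E.
Proof.
have mF := measurable_run j F; have mi := measurable_incr j.
have m01 : measurable (cell 0 0) by exact: measurable_itv.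
rewrite -(setTI (_ @^-1` _)) -(setUv (cell 0 0)) setIUl integral_setU.
- have := integral_incr_cell 0 0 j F; rewrite add0n => ->; rewrite add0e.
  apply: null_set_integral.
  + by apply: measurableI => //; exact: measurableC.
  + by apply/measurable_EFinP; exact: measurable_funTS.
  apply/eqP; rewrite -measure_le0; apply: (@le_trans _ _ (unif (~` cell 0 0))).
    by apply: le_measure; rewrite ?inE//; [apply: measurableI => //|]; exact: measurableC.
  by rewrite probability_setC// cell0 unif_itv// subr0 subee.
- exact: measurableI.
- by apply: measurableI => //; exact: measurableC.
- by apply/measurable_EFinP; exact: measurable_funTS.
- by apply/disj_setPS => x [[/= h _] [/= h' _]]; exact: h'.
Qed.

(** * The law of the random trajectory *)

Lemma preimage_generated d (aT : measurableType d) (rT : Type) (f : aT -> rT)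
    (G : set (set rT)) : (forall A, G A -> measurable (f @^-1` A)) ->
  forall A, <<s G >> A -> measurable (f @^-1` A).
Proof.
move=> mG; apply: smallest_sub; last exact: mG.
split => [|A mA|A mA]; first by rewrite preimage_set0.
- by rewrite setTD preimage_setC; exact: measurableC.
- by rewrite preimage_bigcup; exact: bigcup_measurable.
Qed.

Definition random_traj (w : measurableTypeR R) : trajMeas R T s0 hs0 :=
  exist _ (path_of w) (path_of_traj w).

Lemma integrable_coordinate i : unif.-integrable setT (fun w => (path_of w i)%:E).
Proof.
apply: (@measurable_bounded_integrable _ _ _ unif (fun w => path_of w i)) => //.
- exact: (le_lt_trans (probability_le1 unif measurableT) (ltry _)).
- exact: (measurable_fun_run i (fun v => sval v.1.1 i)).
- have [M MP] := bounded_run i (fun v => sval v.1.1 i).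
  by exists M; split; rewrite ?num_real// => x Mx y _; apply: le_trans (MP y) (ltW Mx).
Qed.

Lemma measurable_random_traj : measurable_fun setT random_traj.
Proof.
move=> _ A mA; rewrite setTI; move: A mA; apply: preimage_generated => _ [B + <-].
move: B; apply: (@preimage_generated _ (measurableTypeR R) _ (fun w => path_of w)).
move=> _ [i _ [B mB <-]].
exact: (measurable_run i ((fun v => sval v.1.1 i) @^-1` B)).
Qed.

Lemma measurable_coordinate i (B : set R) : measurable B ->
  measurable ((fun s : trajMeas R T s0 hs0 => sval s i) @^-1` B).
Proof.
move=> mB; apply: sub_sigma_algebra; exists ((fun s : nat -> R => s i) @^-1` B) => //.
by apply: sub_sigma_algebra; exists i => //; exists B.
Qed.

Lemma nat_filtration_measurable i A : nat_filtration R T s0 hs0 i A -> measurable A.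
Proof.
move: A; apply: smallest_sub; first exact: smallest_sigma_algebra.
by move=> _ [j _ [B mB <-]]; exact: measurable_coordinate.
Qed.

(** An event of date [i] depends only on the prices up to [i], which the state at stage [i]
    determines. *)
Lemma nat_filtration_run i A : nat_filtration R T s0 hs0 i A ->
  exists F : set state, random_traj @^-1` A = (fun w => run w i) @^-1` F.
Proof.
move=> FA.
have inv : forall s s' : trajMeas R T s0 hs0, agree i (sval s) (sval s') -> A s -> A s'.
  move: A FA; apply: smallest_sub.
    split => [//|A IH s s' ss' [_ nA]|A IH s s' ss' [n _ An]].
      by split => // A'; apply: nA; apply: IH A'; exact: agree_sym.
    by exists n => //; exact: IH An.
  by move=> _ [j ji [B mB <-]] s s' ss' /=; rewrite ss'.
exists [set v | exists2 w, run w i = v & A (random_traj w)].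
apply/seteqP; split => w /=; first by exists w.
move=> [w' e]; apply: inv => /=.
apply: agree_trans (path_of_agree w' i) _; rewrite /node_traj e.
exact/agree_sym/path_of_agree.
Qed.

Lemma M0_nonempty_splitting : M0_nonempty R T.
Proof.
pose X : {mfun measurableTypeR R >-> trajMeas R T s0 hs0} := 
  mfun_Sub (mem_set measurable_random_traj).
exists s0, hs0, (distribution unif X).
have mc i : measurable_fun [set: trajMeas R T s0 hs0] (fun s => (sval s i)%:E : \bar R).
  by apply/measurable_EFinP => _ B mB; rewrite setTI; exact: measurable_coordinate.
have mXA A : measurable A -> measurable (random_traj @^-1` A).
  by move=> mA; rewrite -[Z in measurable Z]setTI; exact: measurable_random_traj.
have ic i A : measurable A ->
    unif.-integrable (random_traj @^-1` A) (EFin \o (fun w => path_of w i)).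
  by move=> mA; apply: integrableS (integrable_coordinate i) => //; exact: mXA.
split.
  move=> i; split; first by apply: integrable_pushforward => //; exact: (ic i setT).
  move=> A FA; have mA := nat_filtration_measurable i A FA.
  rewrite !integral_pushforward//; [|exact: (ic i A)|exact: (ic i.+1 A)].
  have [F FE] := nat_filtration_run i A FA.
  have e := integral_incr i F; rewrite -FE in e.
  have := integralB_EFin (mXA A mA) (ic i.+1 A mA) (ic i A mA).
  move=> /esym/(fun h => etrans h e)/eqP; rewrite sube_eq ?add0e//; first by move/eqP.
  exact: (integrable_fin_num (mXA A mA) (ic i.+1 A mA)).
(* Trajectories whose initial segments are all reached by the run. Finite unions at each date and a
   countable intersection over dates make this set measurable. *)
pose S' : set (trajMeas R T s0 hs0) := \bigcap_j \bigcup_(v in range (fun w => run w j))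
  \bigcap_(i in `I_j.+1) [set s | sval s i = sval v.1.1 i].
have S'P w : S' (random_traj w).
  move=> j _; exists (run w j); first by exists w.
  by move=> i /= ij; exact: path_of_agree.
exists S'; split; [|split].
- apply: bigcapT_measurable => j; apply: fin_bigcup_measurable; first exact: finite_run.
  move=> v _; apply: fin_bigcap_measurable; first exact: finite_II.
  by move=> i _; exact: (measurable_coordinate i [set sval v.1.1 i]).
- rewrite /distribution/= /pushforward (_ : _ @^-1` _ = setT) ?probability_setT//.
  by apply/seteqP; split => // w _; exact: S'P.
- move=> j; apply: (@sub_finite_set _ _
    [set node T (sval v.1.1) j | v in range (fun w => run w j)]).
    move=> _ [s Ss <-]; have [v vr sv] := Ss j I.
    by exists v => //; apply: node_agree => i ij; rewrite sv.
  by apply: finite_image; exact: finite_run.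
Qed.

End Splitting.

Lemma M0_nonempty_complete {R : realType} (T : set (nat -> R)) : (exists S, T S) ->
  complete R T -> no_typeII_arbitrage R T -> M0_nonempty R T.
Proof.
move=> [s0 hs0] cT ntII.
have /choice[f fP] : forall p : nat * {S | T S}, exists q : {S | T S} * {S | T S} * R,
    [/\ agree p.1 (sval q.1.1) (sval p.2), agree p.1 (sval q.1.2) (sval p.2), 0 < q.2 < 1 &
     q.2 * sval q.1.1 p.1.+1 + (1 - q.2) * sval q.1.2 p.1.+1 = sval p.2 p.1].
  move=> [j [S TS]] /=.
  case: (flat_or_opposite T S j ntII TS) => [[c [Tc cS] cj]|[c [d [[Tc cS] [Td dS] cj dj]]]].
    (* A flat successor is used twice, so any weight in (0, 1) would do. *)
    exists (exist _ c Tc, exist _ c Tc, 2^-1) => /=; split => //; last by rewrite cj; ring.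
    by rewrite invr_gt0 ltr0n invf_lt1 ?ltr1n.
  have /zero_weights[a [b [a0 b0 ab abe]]] : (c j.+1 - S j) * (d j.+1 - S j) < 0.
    by rewrite pmulr_rlt0 ?subr_gt0// subr_lt0.
  exists (exist _ c Tc, exist _ d Td, a) => /=; split => //; first by lra.
  have -> : 1 - a = b by lra.
  have -> : S j = (a + b) * S j by rewrite ab mul1r.
  by apply/eqP; rewrite -subr_eq0; apply/eqP; rewrite -[RHS]abe; ring.
apply: (M0_nonempty_splitting T cT s0 hs0 (fun j x => (f (j, x)).1.1)
  (fun j x => (f (j, x)).1.2) (fun j x => (f (j, x)).2)) => j x;
  by have [h1 h2 /andP[h3 h4] h5] := fP (j, x).
Qed.

Theorem theorem6p6 (R : realType) (S : set (nat -> R)) :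
  traj_set R S -> complete R S -> no_typeII_arbitrage R S ->
  M0_nonempty R S /\ condnL R S /\ condnK R S.
Proof.
move=> [exS _] cS ntII; split; first exact: M0_nonempty_complete.
(* Both hypotheses pass to the shifted spaces, which reduces (nL) and (nK) to (L), (LOP) and (K). *)
have cs x j : complete R (shifted S x j) := complete_shifted S x j cS.
have ns x j : no_typeII_arbitrage R (shifted S x j) := no_typeII_shifted S x j ntII.
have es x j : S x -> exists y, shifted S x j y by move=> /(traj_set_shifted S x j)[].
split=> x j Sx; first exact: condL_complete (cs x j) (ns x j) (es x j Sx).
split; first exact: condLOP_complete (cs x j) (ns x j) (es x j Sx).
exact: condK_complete (cs x j) (ns x j) (es x j Sx).
Qed.
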